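(* Let $m_0\ge 0$ be an integer and let $\{\lambda_m\}_{m\ge m_0}$ be a sequence of (real or complex) numbers with $\lambda_m(5-\lambda_m)=\lambda_{m-1}$ for all $m>m_0$ and such that the limit $\lambda=\frac32\lim_{m\to\infty}5^m\lambda_m$ exists (and is finite); assume $\lambda_{m_0}\neq 0$. Let $A_0(\cdot)$ and $A_0=A_0(0)$ be the $3\times 3$ matrices defined in the context. Let $\alpha=(0,1,1)^T$, $\beta=(0,1,-1)^T$, and $\gamma_m=(4,4-\lambda_m,4-\lambda_m)^T$. If neither of the values $2$ or $5$ occurs in the sequence $\{\lambda_m\}_{m>m_0}$, then $$\lim_{k\to\infty}A_0^{-k}\cdot A_0(\lambda_{m_0+k})A_0(\lambda_{m_0+k-1})\cdots A_0(\lambda_{m_0+1})\,\alpha=\frac{4\lambda}{3\cdot 5^{m_0}\lambda_{m_0}(2-\lambda_{m_0+1})}\prod_{j=2}^{\infty}\Bigl(1-\frac{\lambda_{m_0+j}}{3}\Bigr)\,\alpha,$$ $$\lim_{k\to\infty}A_0^{-k}\cdot A_0(\lambda_{m_0+k})A_0(\lambda_{m_0+k-1})\cdots A_0(\lambda_{m_0+1})\,\beta=\frac{2\lambda}{3\cdot 5^{m_0}\lambda_{m_0}}\,\beta,$$ $$\lim_{k\to\infty}A_0^{-k}\cdot A_0(\lambda_{m_0+k})A_0(\lambda_{m_0+k-1})\cdots A_0(\lambda_{m_0+1})\,\gamma_{m_0}=(4,4,4)^T.$$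
   Context: For a number $\mu\neq 2,5$ define $$A_0(\mu)=\frac{1}{(5-\mu)(2-\mu)}\begin{pmatrix}(5-\mu)(2-\mu)&0&0\\ 4-\mu&4-\mu&2\\ 4-\mu&2&4-\mu\end{pmatrix},$$ and set $$A_0=A_0(0)=\frac15\begin{pmatrix}5&0&0\\2&2&1\\2&1&2\end{pmatrix}.$$ The matrix $A_0$ is invertible and $A_0^{-k}=(A_0^{-1})^k$. The infinite product $\prod_{j=2}^\infty$ denotes the limit of its partial products. *)

(* Defs.v *)
From HB Require Import structures.
From mathcomp Require Import all_boot all_order all_algebra.
From mathcomp Require Import all_classical all_reals all_analysis.
From mathcomp Require Import complex ring.

Set Implicit Arguments.
Unset Strict Implicit.
Unset Printing Implicit Defensive.

Import Order.TTheory GRing.Theory Num.Theory.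
Import numFieldNormedType.Exports.

Local Open Scope ring_scope.

(* The library equips abstract number fields with the topology of their norm,
   but not the concrete type R[i]: transfer it from R[i]^o. *)
HB.instance Definition _ (R : realType) := GRing.ComAlgebra.copy R[i] R[i]^o.
HB.instance Definition _ (R : realType) := Vector.copy R[i] R[i]^o.
HB.instance Definition _ (R : realType) := NormedModule.copy R[i] R[i]^o.

Definition A0mu (K : fieldType) (mu : K) : 'M[K]_3 :=
  (1 / ((5 - mu) * (2 - mu))) *:
  \matrix_(i < 3, j < 3)
    (nth [::] [:: [:: (5 - mu) * (2 - mu); 0; 0];
                  [:: 4 - mu; 4 - mu; 2];
                  [:: 4 - mu; 2; 4 - mu]] i)`_j.

Definition A0 (K : fieldType) : 'M[K]_3 := A0mu 0.

Lemma A0E (K : numFieldType) :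
  A0 K = 1 / 5 *:
    \matrix_(i < 3, j < 3)
      (nth [::] [:: [:: 5; 0; 0]; [:: 2; 2; 1]; [:: 2; 1; 2]] i)`_j.
Proof.
by apply/matrixP => -[[|[|[|//]]] i] [[|[|[|//]]] j]; rewrite !mxE /=; field.
Qed.

Lemma A0_unit (K : numFieldType) : A0 K \is a GRing.unit.
Proof.
pose B : 'M[K]_3 := \matrix_(i < 3, j < 3)
  (nth [::] [:: [:: 1; 0; 0]; [:: - 2 / 3; 10 / 3; - 5 / 3];
                [:: - 2 / 3; - 5 / 3; 10 / 3]] i)`_j.
suff /mulmx1_unit[] : A0 K *m B = 1%:M by [].
apply/matrixP => -[[|[|[|//]]] i] [[|[|[|//]]] j];
  by rewrite A0E !mxE !big_ord_recl big_ord0 !mxE /=; field.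
Qed.

Definition alphav (K : fieldType) : 'cV[K]_3 := \col_(i < 3) [:: 0; 1; 1]`_i.

Definition betav (K : fieldType) : 'cV[K]_3 := \col_(i < 3) [:: 0; 1; -1]`_i.

Definition gammav (K : fieldType) (lam : nat -> K) (m : nat) : 'cV[K]_3 :=
  \col_(i < 3) [:: 4; 4 - lam m; 4 - lam m]`_i.

(* The factor of index i = 0, that is A0mu (lam (m0 + k)), is the leftmost one,
   and the rightmost one is A0mu (lam (m0 + 1)). *)
Definition A0_prod (K : fieldType) (lam : nat -> K) (m0 k : nat) : 'M[K]_3 :=
  \prod_(i < k) A0mu (lam (m0 + (k - i))%N).

(* Main.v *)
(* The vectors alpha, beta and (c, c, c)^T are eigenvectors of A0, and alpha and
   beta are eigenvectors of every A0(mu), while A0(lam_m) maps gamma_(m-1) to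
   gamma_m. The recurrence gives 1 / (5 - lam_m) = lam_m / lam_(m-1) and
   6 - lam_(m-1) = (2 - lam_m) (3 - lam_m), so that both products of eigenvalues
   telescope and A0^-k A0(lam_(m0+k)) ... A0(lam_(m0+1)) acts on each of the
   three vectors in closed form. As 5^m lam_m converges, lam_m is summable, which
   makes the remaining infinite product converge. *)
Require Import Defs.
From HB Require Import structures.
From mathcomp Require Import all_boot all_order all_algebra.
From mathcomp Require Import all_classical all_reals all_analysis.
From mathcomp Require Import complex.
From mathcomp Require Import ring.

Set Implicit Arguments.
Unset Strict Implicit.
Unset Printing Implicit Defensive.

Import Order.TTheory GRing.Theory Num.Theory.
Import numFieldNormedType.Exports.

Local Open Scope ring_scope.
Local Open Scope classical_set_scope.

(** * Convergence of sequences and infinite products in [R[i]] *)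

Section Complex_sequences.
Variable R : realType.
Import Normc.
Local Open Scope complex_scope.

Lemma cvg_real_complex (x : nat -> R) (l : R) :
  x @ \oo --> l -> (fun n => (x n)%:C : R[i]) @ \oo --> (l%:C : R[i]).
Proof.
move=> xl; apply/cvgrPdist_lt => e e0.
(* A positive element of [R[i]] is real, so the tolerance comes from a real one. *)
have eE : e = (complex.Re e)%:C by rewrite RRe_real // gtr0_real.
have Re0 : 0 < complex.Re e by rewrite -ltcR -eE.
move/cvgrPdist_lt : xl => /(_ _ Re0); apply: filterS => n.
by rewrite eE -rmorphB normc_def /= expr0n addr0 sqrtr_sqr ltcR.
Qed.

Lemma cvg_exprVn_complex p : (1 < p)%N ->
  (fun n => (p%:R^-1 : R[i]) ^+ n) @ \oo --> (0 : R[i]).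
Proof.
move=> p1; have /cvg_expr/cvg_real_complex : `|p%:R^-1 : R| < 1.
  by rewrite ger0_norm ?invr_ge0 // invf_lt1 ?ltr1n // ltr0n ltnW.
rewrite rmorph0; under eq_fun do rewrite rmorphXn /= fmorphV rmorph_nat.
by [].
Qed.

Lemma is_cvg_complex (u : nat -> R[i]) :
  cvgn (fun n => complex.Re (u n)) -> cvgn (fun n => complex.Im (u n)) -> cvgn u.
Proof.
move=> /cvg_real_complex uR /cvg_real_complex uI.
rewrite (_ : u = fun n =>
    (complex.Re (u n))%:C + 'i%C * (complex.Im (u n))%:C); last first.
  by apply/funext => n; exact: complexE.
apply: cvgP; apply: cvgD uR _; apply: cvgM uI; exact: cvg_cst.
Qed.

Lemma le_Re_normc (z : R[i]) : `|complex.Re z| <= normc z.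
Proof. by rewrite -lecR; exact: normc_ge_Re. Qed.

Lemma normc_ge0 (z : R[i]) : 0 <= normc z.
Proof. exact: le_trans (le_Re_normc z). Qed.

Lemma le_Im_normc (z : R[i]) : `|complex.Im z| <= normc z.
Proof.
case: z => a b /=; rewrite -sqrtr_sqr ler_sqrt ?addr_ge0 ?sqr_ge0 //.
by rewrite lerDr sqr_ge0.
Qed.

(** Real and imaginary parts are 1-Lipschitz for [normc], so their telescoping series converge
    absolutely by comparison with [series v]. *)
Lemma is_cvg_dist_le (u : nat -> R[i]) (v : nat -> R) :
  (forall n, normc (u n.+1 - u n) <= v n) -> cvgn (series v) -> cvgn u.
Proof.
move=> uv cv; suff cvg_part (f : R[i] -> R) : {morph f : x y / x - y} ->
    (forall z, `|f z| <= normc z) -> cvgn (fun n => f (u n)).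
  by apply: is_cvg_complex; apply: cvg_part;
    [exact: raddfB|exact: le_Re_normc|exact: raddfB|exact: le_Im_normc].
move=> fB fle.
have dle n : `|telescope (f \o u) n| <= v n.
  by rewrite /telescope /= -fB; apply: le_trans (uv n).
have cS : cvgn (series (telescope (f \o u))).
  apply: normed_cvg; apply: series_le_cvg (dle) cv => // n.
  by apply: le_trans (dle n).
rewrite (_ : (fun n => _) = (fun n => f (u 0%N) + series (telescope (f \o u)) n)).
  by apply: is_cvgD => //; exact: is_cvg_cst.
by apply/funext => n; exact: (eq_sum_telescope (f \o u)).
Qed.

(** By $1 + x \le e^x$ the partial products $P_n$ are bounded by $e^M$, where $M$ bounds the partial
    sums of $|a_n|$. The increments $P_n a_n$ are then dominated by the summable $e^M |a_n|$. *)
Lemma is_cvg_prod1D (a : nat -> R[i]) m :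
  cvgn (series (fun n => normc (a n))) ->
  cvgn (fun n => \prod_(m <= j < n) (1 + a j)).
Proof.
move=> ca; have [M aM] : exists M, forall n, series (fun n => normc (a n)) n <= M.
  have /cvg_seq_bounded/bounded_fun_has_ubound[M aM] := ca.
  by exists M => n; apply: aM; exists n.
have PM n : normc (\prod_(m <= j < n) (1 + a j)) <= expR M.
  apply: (@le_trans _ _ (expR (series (fun n => normc (a n)) n))); last first.
    by rewrite ler_expR.
  elim: n => [|n IH].
    by rewrite big_geq // normc1 seriesEnat /= big_geq // expR0.
  (* The sum starts at 0 but the product at [m]; when [n < m] the product up to [n.+1] is still
     empty. *)
  rewrite seriesSr expRD; have [mn|nm] := leqP m n; last first.
    rewrite big_geq // normc1; apply: mulr_ege1.
      rewrite -expR0 ler_expR seriesEnat /=.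
      by apply: sumr_ge0 => i _; exact: normc_ge0.
    by rewrite -expR0 ler_expR normc_ge0.
  rewrite big_nat_recr //= normcM; apply: ler_pM; rewrite ?normc_ge0 //.
  apply: le_trans (expR_ge1Dx _).
  by apply: le_trans (le_normcD _ _) _; rewrite normc1.
apply: (is_cvg_dist_le (v := fun n => expR M * normc (a n))).
  move=> n; have [mn|nm] := leqP m n; last first.
    by rewrite !big_geq // ?subrr ?normc0 ?mulr_ge0 ?expR_ge0 ?normc_ge0 // ltnW.
  rewrite big_nat_recr //= mulrDr mulr1 addrAC subrr add0r normcM.
  by apply: ler_wpM2r; first exact: normc_ge0.
rewrite (_ : (fun n => _) = expR M *: (fun n => normc (a n))); last by apply/funext.
exact: is_cvg_seriesZ.
Qed.

(** A convergent sequence is bounded, so [normc (u n)] is dominated by a geometric sequence of ratio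
    [q^-1]. *)
Lemma is_cvg_series_normc (u : nat -> R[i]) (q : R) : 1 < q ->
  cvgn (fun n => q%:C ^+ n * u n) -> cvgn (series (fun n => normc (u n))).
Proof.
move=> q1 /cvg_seq_bounded/pinfty_ex_gt0[M _ qu].
have q0 : 0 < q by apply: lt_trans q1.
have uM n : normc (u n) <= geometric (complex.Re M) q^-1 n.
  have : (normc (q%:C ^+ n * u n))%:C <= M := qu n I.
  rewrite lecE => /andP[_] /=; rewrite normcM -rmorphXn /=.
  rewrite expr0n addr0 sqrtr_sqr ger0_norm ?exprn_ge0 ?(ltW q0) //.
  by rewrite exprVn ler_pdivlMr ?exprn_gt0 // mulrC.
apply: (series_le_cvg _ _ uM) => [n|n|].
- exact: normc_ge0.
- exact: le_trans (normc_ge0 _) (uM n).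
- apply: is_cvg_geometric_series.
  by rewrite ger0_norm ?invr_ge0 ?(ltW q0) // invf_lt1.
Qed.

End Complex_sequences.

(** * Eigenvectors of [A0] and [A0mu mu] *)

Lemma mulmx_invX_eigen (K : fieldType) n p (A : 'M[K]_n.+1) (v : 'M[K]_(n.+1, p))
    (c : K) k :
  A \is a GRing.unit -> c != 0 -> A *m v = c *: v ->
  A ^- k *m v = c ^- k *: v.
Proof.
move=> Au c0 Av; have AXv : A ^+ k *m v = c ^+ k *: v.
  elim: k => [|k IH]; first by rewrite !expr0 mul1mx scale1r.
  by rewrite exprS -mulmxA IH -scalemxAr Av scalerA -exprSr.
have ck0 : c ^+ k != 0 by rewrite expf_neq0.
apply: (scalerI ck0); rewrite scalemxAr -AXv mulmxA scalerA divff // scale1r.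
by rewrite [_ *m A ^+ k]mulVr ?unitrX // mul1mx.
Qed.

Lemma A0mu_alpha (K : fieldType) (mu : K) : mu != 2 -> mu != 5 ->
  A0mu mu *m alphav K = ((6 - mu) / ((5 - mu) * (2 - mu))) *: alphav K.
Proof.
rewrite ![mu == _]eq_sym -![_ == mu]subr_eq0 => mu2 mu5.
by apply/matrixP => -[[|[|[|//]]] i] [[|//] j];
  rewrite !mxE !big_ord_recl big_ord0 !mxE /=; field; apply/andP.
Qed.

Lemma A0mu_beta (K : fieldType) (mu : K) : mu != 2 -> mu != 5 ->
  A0mu mu *m betav K = (5 - mu)^-1 *: betav K.
Proof.
rewrite ![mu == _]eq_sym -![_ == mu]subr_eq0 => mu2 mu5.
by apply/matrixP => -[[|[|[|//]]] i] [[|//] j];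
  rewrite !mxE !big_ord_recl big_ord0 !mxE /=; field; apply/andP.
Qed.

Lemma A0mu_gamma (K : fieldType) (lam : nat -> K) m :
  lam m.+1 * (5 - lam m.+1) = lam m -> lam m.+1 != 2 -> lam m.+1 != 5 ->
  A0mu (lam m.+1) *m gammav lam m = gammav lam m.+1.
Proof.
rewrite ![_ == 2]eq_sym ![_ == 5]eq_sym -![_ == lam _]subr_eq0 => lamE mu2 mu5.
by apply/matrixP => -[[|[|[|//]]] i] [[|//] j];
  rewrite !mxE !big_ord_recl big_ord0 !mxE /= -lamE; field; apply/andP.
Qed.

(** This splits $\gamma_m$ along eigenvectors of [A0] for the eigenvalues 1 and 3/5, so that
    [A0 K ^- k] can be applied to it. *)
Lemma gammavE (K : fieldType) (lam : nat -> K) m :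
  gammav lam m = const_mx 4 - lam m *: alphav K.
Proof.
by apply/matrixP => -[[|[|[|//]]] i] [[|//] j]; rewrite !mxE /=; ring.
Qed.

Lemma A0_alpha (K : numFieldType) : A0 K *m alphav K = (3 / 5) *: alphav K.
Proof.
by rewrite A0mu_alpha ?subr0 ?[0 == _]eq_sym ?pnatr_eq0 //; congr (_ *: _); field.
Qed.

Lemma A0_beta (K : numFieldType) : A0 K *m betav K = 5^-1 *: betav K.
Proof. by rewrite A0mu_beta ?subr0 ?[0 == _]eq_sym ?pnatr_eq0. Qed.

Lemma A0_const (K : numFieldType) (c : K) :
  A0 K *m const_mx c = const_mx c :> 'cV_3.
Proof.
by rewrite A0E; apply/matrixP => -[[|[|[|//]]] i] [[|//] j];
  rewrite !mxE !big_ord_recl big_ord0 !mxE /=; field.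
Qed.

Lemma A0_invX_alpha (K : numFieldType) k :
  A0 K ^- k *m alphav K = (5 / 3) ^+ k *: alphav K.
Proof.
rewrite (mulmx_invX_eigen _ (A0_unit K) _ (A0_alpha K)).
  by rewrite -exprVn invf_div.
by rewrite mulf_neq0 ?invr_eq0 ?pnatr_eq0.
Qed.

Lemma A0_invX_beta (K : numFieldType) k :
  A0 K ^- k *m betav K = 5 ^+ k *: betav K.
Proof.
by rewrite (mulmx_invX_eigen _ (A0_unit K) _ (A0_beta K)) ?exprVn ?invrK.
Qed.

Lemma A0_invX_const (K : numFieldType) (c : K) k :
  A0 K ^- k *m const_mx c = const_mx c :> 'cV_3.
Proof.
rewrite (mulmx_invX_eigen (c := 1) _ (A0_unit K)) ?oner_eq0 //.
  by rewrite expr1n invr1 scale1r.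
by rewrite A0_const scale1r.
Qed.

Lemma A0_prodS (K : fieldType) (lam : nat -> K) m0 k :
  A0_prod lam m0 k.+1 = A0mu (lam (m0 + k.+1)%N) * A0_prod lam m0 k.
Proof. by rewrite /A0_prod big_ord_recl. Qed.

(** * Telescoping of the matrix products along the sequence *)

Section Spectral_decimation.
Variables (K : numFieldType) (lam : nat -> K) (m0 : nat).
Hypothesis lam_rec : forall m, (m0 < m)%N -> lam m * (5 - lam m) = lam m.-1.
Hypothesis lam_m0 : lam m0 != 0.
Hypothesis lam_neq : forall m, (m0 < m)%N -> lam m != 2 /\ lam m != 5.

Let lamS k : lam (m0 + k)%N = lam (m0 + k).+1 * (5 - lam (m0 + k).+1).
Proof. by rewrite lam_rec // ltnS leq_addr. Qed.

Let lamN k : lam (m0 + k).+1 != 2 /\ lam (m0 + k).+1 != 5.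
Proof. by apply: lam_neq; rewrite ltnS leq_addr. Qed.

(** With $l_j = \lambda_{m_0+j}$, the eigenvalue of the $j$-th factor is $3 \cdot
    \frac{l_j}{l_{j-1}} \cdot \frac{2-l_{j+1}}{2-l_j} \cdot (1 - \frac{l_{j+1}}{3})$. Two of these
    ratios telescope, and the shift to $l_{j+1}$ makes the remaining product start at 2. *)
Lemma A0_prod_alpha k :
  A0_prod lam m0 k *m alphav K =
  (3 ^+ k * (lam (m0 + k)%N / lam m0) *
   ((2 - lam (m0 + k).+1) / (2 - lam m0.+1)) *
   \prod_(2 <= j < k.+2) (1 - lam (m0 + j)%N / 3)) *: alphav K.
Proof.
elim: k => [|k IH].
  have [+ _] := lamN 0; rewrite addn0 eq_sym -subr_eq0 => l2.
  by rewrite /A0_prod big_ord0 big_geq // mul1mx !divff // !mul1r scale1r.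
rewrite A0_prodS -mulmxA IH -scalemxAr addnS.
have [l2 l5] := lamN k; have [l0 _] := lamN 0.
rewrite A0mu_alpha // scalerA; congr (_ *: _).
(* Two uses of the recurrence express the last terms through [nu]; what remains is a rational
   identity resting on $6 - \nu(5-\nu) = (2-\nu)(3-\nu)$. *)
rewrite [in RHS]big_nat_recr //= !addnS exprS lamS.
move: l0 l2 l5; have := lamS k.+1; rewrite addnS => ->.
set nu := lam _.+2; set P := \prod_(_ <= _ < _) _; rewrite addn0.
rewrite ![_ == 2]eq_sym ![_ == 5]eq_sym -![_ == lam _]subr_eq0.
rewrite -![_ == nu * _]subr_eq0 => l0 mu2 mu5.
by field; rewrite lam_m0 mu2 mu5 l0.
Qed.

Lemma A0_prod_beta k :
  A0_prod lam m0 k *m betav K = (lam (m0 + k)%N / lam m0) *: betav K.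
Proof.
elim: k => [|k IH].
  by rewrite /A0_prod big_ord0 addn0 mul1mx divff // scale1r.
rewrite A0_prodS -mulmxA IH -scalemxAr addnS.
have [l2 l5] := lamN k; rewrite A0mu_beta // scalerA; congr (_ *: _).
move: l5; rewrite eq_sym -subr_eq0 lamS => l5.
by field; rewrite lam_m0 l5.
Qed.

Lemma A0_prod_gamma k :
  A0_prod lam m0 k *m gammav lam m0 = gammav lam (m0 + k)%N.
Proof.
elim: k => [|k IH]; first by rewrite /A0_prod big_ord0 addn0 mul1mx.
have [l2 l5] := lamN k.
by rewrite A0_prodS -mulmxA IH addnS A0mu_gamma // -lamS.
Qed.

(** The factor $3^k$ cancels against $(5/3)^k$, leaving the convergent quantity $5^k
    \lambda_{m_0+k}$. *)
Lemma A0_invX_prod_alpha k :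
  A0 K ^- k *m A0_prod lam m0 k *m alphav K =
  ((5 ^+ k * lam (m0 + k)%N / lam m0) *
   ((2 - lam (m0 + k).+1) / (2 - lam m0.+1)) *
   \prod_(2 <= j < k.+2) (1 - lam (m0 + j)%N / 3)) *: alphav K.
Proof.
rewrite -mulmxA A0_prod_alpha -scalemxAr A0_invX_alpha scalerA.
by rewrite [_ * (5 / 3) ^+ k]mulrC expr_div_n !mulrA divfK ?expf_neq0 ?pnatr_eq0.
Qed.

Lemma A0_invX_prod_beta k :
  A0 K ^- k *m A0_prod lam m0 k *m betav K =
  (5 ^+ k * lam (m0 + k)%N / lam m0) *: betav K.
Proof.
by rewrite -mulmxA A0_prod_beta -scalemxAr A0_invX_beta scalerA mulrC mulrA.
Qed.

(** Writing $(5/3)^k$ as $3^{-k} 5^k$ exhibits the coefficient of $\alpha$ as a null sequence times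
    a convergent one. *)
Lemma A0_invX_prod_gamma k :
  A0 K ^- k *m A0_prod lam m0 k *m gammav lam m0 =
  const_mx 4 - (3^-1 ^+ k * (5 ^+ k * lam (m0 + k)%N)) *: alphav K.
Proof.
rewrite -mulmxA A0_prod_gamma gammavE mulmxBr A0_invX_const -scalemxAr.
rewrite A0_invX_alpha scalerA; congr (_ - _ *: _).
by rewrite expr_div_n exprVn mulrC -mulrA mulrCA.
Qed.

End Spectral_decimation.

(** * Passage to the limit *)

Theorem theorem2p2 (R : realType) (m0 : nat) (lam : nat -> R[i]) (lambda : R[i])
    (lam_rec : forall m, (m0 < m)%N -> lam m * (5 - lam m) = lam m.-1)
    (lam_cvg : cvgn (fun m => 5 ^+ m * lam m))
    (lambdaE : lambda = 3 / 2 * limn (fun m => 5 ^+ m * lam m))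
    (lam_m0 : lam m0 != 0)
    (lam_neq : forall m, (m0 < m)%N -> lam m != 2 /\ lam m != 5) :
  cvgn (fun n => \prod_(2 <= j < n) (1 - lam (m0 + j)%N / 3)) /\
  [/\ (fun k => A0 R[i] ^- k *m A0_prod lam m0 k *m alphav R[i]) @ \oo -->
        (4 * lambda / (3 * 5 ^+ m0 * lam m0 * (2 - lam m0.+1)) *
         limn (fun n => \prod_(2 <= j < n) (1 - lam (m0 + j)%N / 3)))
        *: alphav R[i],
      (fun k => A0 R[i] ^- k *m A0_prod lam m0 k *m betav R[i]) @ \oo -->
        (2 * lambda / (3 * 5 ^+ m0 * lam m0)) *: betav R[i]
    & (fun k => A0 R[i] ^- k *m A0_prod lam m0 k *m gammav lam m0) @ \oo -->
        (const_mx 4 : 'cV[R[i]]_3)].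
Proof.
set L := limn _ in lambdaE.
set P := fun n => \prod_(2 <= j < n) (1 - lam (m0 + j)%N / 3).
have n5 : (5 : R[i]) != 0 by rewrite pnatr_eq0.
have n5X m : (5 : R[i]) ^+ m != 0 by rewrite expf_neq0.
have cst_cvg (c : R[i]) : (fun _ : nat => c) @ \oo --> c by exact: cvg_cst.
have muL : (fun k => 5 ^+ k * lam (m0 + k)%N) @ \oo --> L / 5 ^+ m0.
  have sL : (fun k => 5 ^+ (k + m0) * lam (k + m0)%N) @ \oo --> L.
    by rewrite (cvg_shiftn m0 (fun m => 5 ^+ m * lam m)).
  rewrite (_ : (fun k => _) = fun k => 5 ^+ (k + m0) * lam (k + m0)%N / 5 ^+ m0).
    by apply: cvgM sL _; exact: cst_cvg.
  by apply/funext => k; rewrite exprD addnC; field.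
have lam0 : (fun k => lam (m0 + k)%N) @ \oo --> (0 : R[i]).
  rewrite (_ : (fun k => _) = fun k => 5^-1 ^+ k * (5 ^+ k * lam (m0 + k)%N)).
    rewrite -(mul0r (L / 5 ^+ m0)); apply: cvgM muL.
    exact: cvg_exprVn_complex.
  by apply/funext => k; rewrite exprVn mulKf.
have lamS0 : (fun k => lam (m0 + k).+1) @ \oo --> (0 : R[i]).
  rewrite (_ : (fun k => _) = fun k => lam (m0 + k.+1)%N).
    by rewrite (cvg_shiftS (fun k => lam (m0 + k)%N)).
  by apply/funext => k; rewrite addnS.
have cP : cvgn P.
  (* Here $a_n = -\lambda_{m_0+n}/3$, and $5^n a_n$ converges by [muL]. *)
  apply: is_cvg_prod1D; apply: (@is_cvg_series_normc _ _ 5); first by rewrite ltr1n.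
  rewrite (_ : (fun n => _) = fun n => 5 ^+ n * lam (m0 + n)%N * (- 3^-1)).
    by apply: cvgP; apply: cvgM muL _; exact: cst_cvg.
  by apply/funext => n; rewrite rmorph_nat; ring.
split=> //; split.
- under eq_fun do rewrite A0_invX_prod_alpha //.
  have PS : (fun k => P k.+2) @ \oo --> limn P.
    by rewrite (cvg_shiftS (fun k => P k.+1)) cvg_shiftS.
  have [+ _] := lam_neq _ (ltnSn m0); rewrite eq_sym -subr_eq0 => l2.
  (* The [2 - 0] is the limit of $2 - \lambda_{m_0+k+1}$; since $L = 2\lambda/3$, it yields the
     constant $4\lambda/3$. *)
  rewrite (_ : _ * limn P =
    L / 5 ^+ m0 / lam m0 * ((2 - 0) / (2 - lam m0.+1)) * limn P).
    apply: cvgZr_tmp; apply: cvgM PS; apply: cvgM.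
      by apply: cvgM muL _; exact: cst_cvg.
    by apply: cvgM; [apply: cvgB lamS0; exact: cst_cvg|exact: cst_cvg].
  by rewrite lambdaE; field; rewrite lam_m0 n5X l2.
- under eq_fun do rewrite A0_invX_prod_beta //.
  rewrite (_ : _ / _ = L / 5 ^+ m0 / lam m0).
    by apply: cvgZr_tmp; apply: cvgM muL _; exact: cst_cvg.
  by rewrite lambdaE; field; rewrite lam_m0 n5X.
- under eq_fun do rewrite A0_invX_prod_gamma //.
  (* The limit is put in the form of a difference for [cvgB]. The rewriting also changes the
     constant inside the sequence, which the next line undoes. *)
  have -> : const_mx 4 = const_mx 4 - 0 *: alphav R[i] by rewrite scale0r subr0.
  apply: cvgB; first by rewrite scale0r subr0; exact: cvg_cst.
  apply: cvgZr_tmp; rewrite -(mul0r (L / 5 ^+ m0)); apply: cvgM muL.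
  exact: cvg_exprVn_complex.
Qed.
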